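(* Let $a\in R$ be EP. Then $a$ is WD invertible and WDMP invertible. Moreover, the group inverse $a^{\#}$ is a WD inverse of $a$ and a WDMP inverse of $a$.
   Context: $R$ is a proper unital ring with involution: an associative ring with $1$ and a map $*:R\to R$ with $(a+b)^*=a^*+b^*$, $(ab)^*=b^*a^*$, $(a^* )^*=a$, such that $a^*a=0$ implies $a=0$. Moore-Penrose inverse: $a^\dagger$ is the unique $x$ (if it exists) with $axa=a$, $xax=x$, $(ax)^*=ax$, $(xa)^*=xa$; $R^\dagger$ is the set of Moore-Penrose invertible elements. An element $a$ is EP if $a\in R^\dagger$ and $aa^\dagger=a^\dagger a$. The group inverse $a^{\#}$ is the unique $x$ with $xa^2=a$, $ax=xa$, $ax^2=x$ (the Drazin inverse for index $1$); every EP element is group invertible. Weak Drazin (WD) inverse: $a\in R$ is WD invertible if there are $x\in R$ and a positive integer $k$ with $axa=a$, $a^{k+1}x=a^k$, $xa^{k+1}=a^k$. The least positive integer $k$ for which such an $x$ exists is the weak Drazin index $\mathrm{ind}(a)$; any $x$ satisfying the three equations with $k=\mathrm{ind}(a)$ is a WD inverse of $a$ (not unique in general), denoted $a^{WD}$. $R^{WD}$ is the set of WD invertible elements. WDMP inverse: for $a\in R^{WD}\cap R^\dagger$, an element $y\in R$ is a WDMP inverse of $a$ if, for some WD inverse $a^{WD}$ of $a$ and $k=\mathrm{ind}(a)$, $yay=y$, $ay=aa^\dagger$, $ya^k=a^{WD}a^k$. An element having a WDMP inverse is called WDMP invertible. *)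

(* Defs.v *)
From mathcomp Require Import all_boot ssralg.

Set Implicit Arguments.
Unset Strict Implicit.
Unset Printing Implicit Defensive.

Import GRing.Theory.
Local Open Scope ring_scope.

Record proper_involution (R : pzRingType) (star : R -> R) : Prop :=
  ProperInvolution {
    star_add : forall a b, star (a + b) = star a + star b;
    star_mul : forall a b, star (a * b) = star b * star a;
    star_invol : forall a, star (star a) = a;
    star_proper : forall a, star a * a = 0 -> a = 0
  }.

(* Inverses that are unique when they exist (Moore-Penrose, group) are given
   by their defining relations; [is_MP_inverse_unique] and
   [is_group_inverse_unique] below justify speaking of "the" inverse. *)

Definition is_MP_inverse (R : pzRingType) (star : R -> R) (a x : R) : Prop :=
  [/\ a * x * a = a, x * a * x = x,
      star (a * x) = a * x & star (x * a) = x * a].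

Definition MP_invertible (R : pzRingType) (star : R -> R) (a : R) : Prop :=
  exists x, is_MP_inverse star a x.

Definition EP (R : pzRingType) (star : R -> R) (a : R) : Prop :=
  exists2 x, is_MP_inverse star a x & a * x = x * a.

Definition is_group_inverse (R : pzRingType) (a x : R) : Prop :=
  [/\ x * a ^+ 2 = a, a * x = x * a & a * x ^+ 2 = x].

Definition group_invertible (R : pzRingType) (a : R) : Prop :=
  exists x, is_group_inverse a x.

Definition WD_equations (R : pzRingType) (a : R) (k : nat) (x : R) : Prop :=
  [/\ a * x * a = a, a ^+ k.+1 * x = a ^+ k & x * a ^+ k.+1 = a ^+ k].

Definition WD_invertible (R : pzRingType) (a : R) : Prop :=
  exists x k, (0 < k)%N /\ WD_equations a k x.

Definition is_WD_index (R : pzRingType) (a : R) (k : nat) : Prop :=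
  [/\ (0 < k)%N, exists x, WD_equations a k x
    & forall j x, (0 < j)%N -> WD_equations a j x -> (k <= j)%N].

Definition is_WD_inverse (R : pzRingType) (a x : R) : Prop :=
  exists2 k, is_WD_index a k & WD_equations a k x.

(* [d] is the Moore-Penrose inverse of [a], [w] some WD inverse of [a], and
   [k] its weak Drazin index; their existence forces [a] to be both WD and
   Moore-Penrose invertible. *)
Definition is_WDMP_inverse (R : pzRingType) (star : R -> R) (a y : R) : Prop :=
  exists d w k,
    [/\ is_MP_inverse star a d, is_WD_inverse a w & is_WD_index a k] /\
    [/\ y * a * y = y, a * y = a * d & y * a ^+ k = w * a ^+ k].

Definition WDMP_invertible (R : pzRingType) (star : R -> R) (a : R) : Prop :=
  exists y, is_WDMP_inverse star a y.

Lemma is_MP_inverse_unique (R : pzRingType) (star : R -> R) (a x y : R) :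
  proper_involution star ->
  is_MP_inverse star a x -> is_MP_inverse star a y -> x = y.
Proof.
move=> [_ starM _ _] [axa xax sax sxa] [aya yay say sya].
have axay : a * x = a * y.
  by rewrite -sax -[in LHS]aya -(mulrA _ a) starM say sax mulrA axa.
have xaya : x * a = y * a.
  by rewrite -sxa -[in LHS]aya -(mulrA a) mulrA starM sya sxa -mulrA (mulrA a) axa.
by rewrite -xax -mulrA axay mulrA xaya yay.
Qed.

Lemma is_group_inverse_unique (R : pzRingType) (a x y : R) :
  is_group_inverse a x -> is_group_inverse a y -> x = y.
Proof.
move=> [xa2 axC ax2] [ya2 ayC ay2].
have axay : a * x = a * y.
  rewrite -[in LHS]ya2 ayC expr2 -!mulrA axC; congr (y * _).
  by rewrite mulrA axC -mulrA -expr2.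
by rewrite -ax2 expr2 mulrA axay ayC -mulrA axay mulrA -ayC -mulrA -expr2.
Qed.

(* Main.v *)
(* If a a^+ = a^+ a then a^+ satisfies the equations of the group inverse, so
   a^# = a^+.  A group inverse satisfies the WD equations for k = 1, the least
   admissible value; hence ind(a) = 1 and a^+ serves at once as the
   Moore-Penrose, WD and WDMP inverse. *)
Require Import Defs.
From mathcomp Require Import all_boot ssralg.

Import GRing.Theory.

Local Open Scope ring_scope.

(** Commutation turns [a * x * a = a] into [x * a ^+ 2 = a], and [x * a * x = x] into
    [a * x ^+ 2 = x]. *)
Lemma EP_MP_is_group_inverse (R : pzRingType) (star : R -> R) (a x : R) :
  is_MP_inverse star a x -> a * x = x * a -> is_group_inverse a x.
Proof.
move=> [axa xax _ _] axC; split=> //.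
- by rewrite expr2 mulrA -axC.
- by rewrite expr2 mulrA axC.
Qed.

Lemma group_inverse_WD_equations (R : pzRingType) (a g : R) :
  is_group_inverse a g -> WD_equations a 1 g.
Proof.
move=> [ga2 agC _]; split; rewrite ?expr1 //.
- by rewrite agC -mulrA -expr2.
- by rewrite expr2 -mulrA agC mulrA agC -mulrA -expr2.
Qed.

(** Minimality is immediate, since [0 < j] is by definition [1 <= j]. *)
Lemma WD_index1 (R : pzRingType) (a x : R) :
  WD_equations a 1 x -> is_WD_index a 1.
Proof. by move=> wd1; split=> //; exists x. Qed.

Theorem theorem2p10 (R : pzRingType) (star : R -> R)
    (hstar : proper_involution star) (a : R) (ha : EP star a) :
  [/\ WD_invertible a, WDMP_invertible star a, group_invertible a
    & forall g : R, is_group_inverse a g ->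
        is_WD_inverse a g /\ is_WDMP_inverse star a g].
Proof.
case: ha => x mpx axC.
have grx := EP_MP_is_group_inverse _ _ _ _ mpx axC.
have wdx := group_inverse_WD_equations _ _ _ grx.
have ind1 := WD_index1 _ _ _ wdx.
have WDx : is_WD_inverse a x by exists 1%N.
have WDMPx : is_WDMP_inverse star a x.
  (* With [x] in all three roles, only [x * a * x = x] is not trivial among the WDMP equations. *)
  by exists x, x, 1%N; split; [split | split=> //; case: mpx].
split; [by exists x, 1%N | by exists x | by exists x |].
(* Uniqueness identifies an arbitrary group inverse [g] with [x]. *)
by move=> g grg; rewrite (is_group_inverse_unique grg grx).
Qed.
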